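(* There exists a recursive coloring function $c:\mathbb{N}\rightarrow \{0,1\}^3$ such that no infinite $\Delta^0_3$ set $A\subseteq\mathbb{N}$ is a solution to $c$ for $\mathrm{HT}^{\leq 3}$, i.e. for every infinite $\Delta^0_3$ set $A$, the set $FS^{\leq 3}(A)$ is not monochromatic under $c$.
   Context: For a set $H\subseteq\mathbb{N}$ and a natural number $k$, $FS^{\leq k}(H)=\{\sum_{x\in F}x : F\subseteq H,\ F\text{ nonempty},\ |F|\leq k\}$. A set $H$ is a solution to $c$ for $\mathrm{HT}^{\leq k}$ if $H$ is infinite and $FS^{\leq k}(H)$ is monochromatic under $c$. *)

(* Defs.v *)
From mathcomp Require Import all_boot.
Set Implicit Arguments. Unset Strict Implicit. Unset Printing Implicit Defensive.

Inductive code : Type :=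
| CZero
| CSucc
| CProj (i : nat)                    (* i-th argument (0 if absent) *)
| CComp (f : code) (gs : seq code)
| CPrec (f g : code)
| CMu (f : code).

Inductive eval : code -> seq nat -> nat -> Prop :=
| eZero xs : eval CZero xs 0
| eSucc xs : eval CSucc xs (head 0 xs).+1
| eProj i xs : eval (CProj i) xs (nth 0 xs i)
| eComp f gs xs ys y :
    evals gs xs ys -> eval f ys y -> eval (CComp f gs) xs y
| ePrec0 f g xs y : eval f xs y -> eval (CPrec f g) (0 :: xs) y
| ePrecS f g n xs r y :
    eval (CPrec f g) (n :: xs) r -> eval g (n :: r :: xs) y ->
    eval (CPrec f g) (n.+1 :: xs) y
| eMu f xs n :
    eval f (n :: xs) 0 ->
    (forall m, m < n -> exists k, eval f (m :: xs) k.+1) ->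
    eval (CMu f) xs n
with evals : seq code -> seq nat -> seq nat -> Prop :=
| esNil xs : evals [::] xs [::]
| esCons g gs xs y ys :
    eval g xs y -> evals gs xs ys -> evals (g :: gs) xs (y :: ys).

Definition recursive1 (f : nat -> nat) : Prop :=
  exists e, forall n, eval e [:: n] (f n).

Definition recursive_rel4 (R : nat -> nat -> nat -> nat -> bool) : Prop :=
  exists e, forall x a b c, eval e [:: x; a; b; c] (nat_of_bool (R x a b c)).

Definition Sigma03 (A : nat -> Prop) : Prop :=
  exists R, recursive_rel4 R /\
    forall x, A x <-> exists a, forall b, exists c, R x a b c.

Definition Delta03 (A : nat -> Prop) : Prop :=
  Sigma03 A /\ Sigma03 (fun x => ~ A x).

Definition colour3 := (bool * bool * bool)%type.

Definition colour_code (b : colour3) : nat :=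
  let: (b1, b2, b3) := b in 4 * b1 + 2 * b2 + b3.

Definition recursive_coloring (c : nat -> colour3) : Prop :=
  recursive1 (fun n => colour_code (c n)).

Definition FSle (k : nat) (H : nat -> Prop) (n : nat) : Prop :=
  exists F : seq nat,
    [/\ uniq F, (forall x, x \in F -> H x), 0 < size F, size F <= k
      & n = sumn F].

Definition infinite_set (H : nat -> Prop) : Prop :=
  forall m, exists n, m <= n /\ H n.

Definition HT_solution (k : nat) (c : nat -> colour3) (H : nat -> Prop) : Prop :=
  infinite_set H /\ exists col, forall n, FSle k H n -> c n = col.

(* Main.v *)
From HB Require Import structures.
Require Import Defs.
From mathcomp Require Import all_boot.
From mathcomp Require Import zify.
From Stdlib Require Import Classical.

Set Implicit Arguments.
Unset Strict Implicit.
Unset Printing Implicit Defensive.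

(** Write numbers in base 3.  One bit of the colour of [n] tells whether its
    lowest nonzero digit is 1: two members of a solution [A] with the same
    3-adic valuation have a sum of the other colour, so the members of [A] are
    eventually divisible by any given power of 3.

    The second bit is the parity of the sum of the numbers
    [weight j (above j n)] over the positions [j] of the nonzero digits of [n],
    where [above j n] is the part of [n] above position [j].  If [u] is
    divisible by a power of 3 larger than [x], then [x + u] contributes the
    terms of [u] and one more term for each nonzero digit of [x].  The last of
    these is [weight j u] for the leading position [j] of [x], and it can be
    chosen to make their total odd: for each [j] and [u] this enforces
    [parity (x + u) <> parity u] for one number [x = target j u].

    Targets are numbers guessed from [u] to lie in [A].  A member of the [e]-th
    Sigma^0_3 set comes with a witness for the outermost quantifier; requirement
    [e] proposes the least pair of a number and a witness that looks correct
    when the universal quantifier is tested up to the valuation of [u] and the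
    innermost existential one up to [u], and whose leading position is not
    already used by a requirement of smaller index.  For [u = y + z] with [y]
    and then [z] in [A] large enough the proposal is correct: among [e + 1]
    correct pairs with distinct leading positions one is available, and all
    smaller incorrect pairs have been refuted.  Then [x + y + z] and [y + z]
    have different colours. *)

(** * Computable functions *)

HB.mixin Record hasCoords X := {
  arity : nat;
  coords : X -> seq nat;
  size_coords : forall x, size (coords x) = arity
}.
#[short(type="natTupleType")]
HB.structure Definition NatTuple := {X of hasCoords X}.
Arguments arity : clear implicits.

HB.instance Definition _ :=
  hasCoords.Build nat (fun n => erefl (size [:: n])).
#[warnings="-redundant-canonical-projection"]
HB.instance Definition _ :=
  hasCoords.Build bool (fun b => erefl (size [:: nat_of_bool b])).

Section Product.
Variables X Y : natTupleType.

Definition prod_coords (p : X * Y) := coords p.1 ++ coords p.2.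

Lemma size_prod_coords p : size (prod_coords p) = arity X + arity Y.
Proof. by rewrite size_cat !size_coords. Qed.

HB.instance Definition _ := hasCoords.Build (X * Y)%type size_prod_coords.

End Product.

Definition computable (X Y : natTupleType) (f : X -> Y) : Prop :=
  exists es, forall x, evals es (coords x) (coords (f x)).

Lemma evals_cat es gs xs ys zs :
  evals es xs ys -> evals gs xs zs -> evals (es ++ gs) xs (ys ++ zs).
Proof.
elim=> [//|e fs us y ys' eval_e _ IH] /IH /=.
exact: esCons.
Qed.

Lemma evals_comp es gs xs ys zs : evals gs xs ys -> evals es ys zs ->
  evals [seq CComp e gs | e <- es] xs zs.
Proof.
move=> gs_ys es_zs; elim: es_zs gs_ys.
  by move=> *; apply: esNil.
move=> e fs us z zs' eval_e _ IH gs_us.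
exact: esCons (eComp gs_us eval_e) (IH gs_us).
Qed.

Lemma eval_const n : exists e, forall xs, eval e xs n.
Proof.
elim: n => [|n [e e_n]]; first by exists CZero => xs; apply: eZero.
exists (CComp CSucc [:: e]) => xs; apply: eComp (eSucc [:: n]).
exact: esCons (e_n xs) (esNil xs).
Qed.

Lemma evals_proj xs ys zs :
  evals [seq CProj i | i <- iota (size xs) (size ys)] (xs ++ ys ++ zs) ys.
Proof.
elim: ys xs => [|y ys IHys] xs /=; first exact: esNil.
apply: esCons.
  by have := eProj (size xs) (xs ++ y :: ys ++ zs); rewrite nth_cat ltnn subnn.
by have := IHys (rcons xs y); rewrite size_rcons cat_rcons.
Qed.

Section Category.
Variables X Y Z : natTupleType.
Implicit Types (f : X -> Y) (g : Y -> Z).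

Lemma eq_computable f f' : f =1 f' -> computable f -> computable f'.
Proof. by move=> ff' [es es_f]; exists es => x; rewrite -ff'. Qed.

Lemma computable_id : computable (fun x : X => x).
Proof.
exists [seq CProj i | i <- iota 0 (arity X)] => x.
by have := evals_proj [::] (coords x) [::]; rewrite cats0 size_coords.
Qed.

Lemma computable_fst : computable (fun p : X * Y => p.1).
Proof.
exists [seq CProj i | i <- iota 0 (arity X)] => -[x y].
by have := evals_proj [::] (coords x) (coords y); rewrite size_coords.
Qed.

Lemma computable_snd : computable (fun p : X * Y => p.2).
Proof.
exists [seq CProj i | i <- iota (arity X) (arity Y)] => -[x y].
by have := evals_proj (coords x) (coords y) [::]; rewrite cats0 !size_coords.
Qed.

Lemma computable_pair f (g : X -> Z) :
  computable f -> computable g -> computable (fun x => (f x, g x)).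
Proof.
by move=> [es es_f] [gs gs_g]; exists (es ++ gs) => x; apply: evals_cat.
Qed.

Lemma computable_comp f g :
  computable g -> computable f -> computable (fun x => g (f x)).
Proof.
move=> [es es_g] [gs gs_f]; exists [seq CComp e gs | e <- es] => x.
exact: evals_comp (gs_f x) (es_g (f x)).
Qed.

Lemma computable_const (y : Y) : computable (fun _ : X => y).
Proof.
suff [es es_y] : exists es, forall xs, evals es xs (coords y) by exists es => x.
elim: (coords y) => [|n ns [es es_ns]].
  by exists [::] => xs; apply: esNil.
have [e e_n] := eval_const n.
by exists (e :: es) => xs; apply: esCons.
Qed.

End Category.

Lemma computable_natP (X : natTupleType) (f : X -> nat) :
  computable f <-> exists e, forall x, eval e (coords x) (f x).
Proof.
split=> [[es es_f] | [e e_f]]; last first.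
  by exists [:: e] => x; apply: esCons (e_f x) (esNil _).
by exists (head CZero es) => x; have := es_f x; inversion_clear 1.
Qed.

Lemma computable_iteri (X : natTupleType) (N f : X -> nat)
    (F : nat -> nat -> X -> nat) :
  computable N -> computable f ->
  computable (fun p : nat * nat * X => F p.1.1 p.1.2 p.2) ->
  computable (fun x => iteri (N x) (fun i r => F i r x) (f x)).
Proof.
move=> [eN eval_N] /computable_natP[ef eval_f] /computable_natP[eF eval_F].
apply/computable_natP; have [eX eval_X] := computable_id X.
exists (CComp (CPrec ef eF) (eN ++ eX)) => x.
apply: (eComp (evals_cat (eval_N x) (eval_X x))).
elim: (N x) => [|n IHn] /=; first exact: ePrec0 (eval_f x).
exact: ePrecS IHn (eval_F (n, iteri n (fun i r => F i r x) (f x), x)).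
Qed.

Lemma computable_iter (X : natTupleType) (N f : X -> nat)
    (F : nat -> X -> nat) :
  computable N -> computable f -> computable (fun p : nat * X => F p.1 p.2) ->
  computable (fun x => iter (N x) (fun r => F r x) (f x)).
Proof.
move=> N_computable f_computable F_computable.
apply: (@eq_computable _ _ (fun x => iteri (N x) (fun _ r => F r x) (f x))).
  by move=> x; elim: (N x) => //= n ->.
apply: computable_iteri => //.
apply: (computable_comp (f := fun p => (p.1.2, p.2)) F_computable).
apply: computable_pair (computable_snd _ _).
exact: computable_comp (computable_snd _ _) (computable_fst _ _).
Qed.

Section Applications.
Variables X Y1 Y2 Y3 Y4 Y : natTupleType.
Variables (f1 : X -> Y1) (f2 : X -> Y2) (f3 : X -> Y3) (f4 : X -> Y4).
Hypotheses (f1_computable : computable f1) (f2_computable : computable f2).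
Hypotheses (f3_computable : computable f3) (f4_computable : computable f4).

Lemma computable_app2 (h : Y1 -> Y2 -> Y) :
  computable (fun p => h p.1 p.2) -> computable (fun x => h (f1 x) (f2 x)).
Proof.
move=> h_computable.
apply: (computable_comp (f := fun x => (f1 x, f2 x)) h_computable).
exact: computable_pair.
Qed.

Lemma computable_app3 (h : Y1 -> Y2 -> Y3 -> Y) :
  computable (fun p => h p.1.1 p.1.2 p.2) ->
  computable (fun x => h (f1 x) (f2 x) (f3 x)).
Proof.
move=> h_computable.
apply: (computable_comp (f := fun x => (f1 x, f2 x, f3 x)) h_computable).
by do 2?apply: computable_pair.
Qed.

Lemma computable_app4 (h : Y1 -> Y2 -> Y3 -> Y4 -> Y) :
  computable (fun p => h p.1.1.1 p.1.1.2 p.1.2 p.2) ->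
  computable (fun x => h (f1 x) (f2 x) (f3 x) (f4 x)).
Proof.
move=> h_computable.
apply: (computable_comp (f := fun x => (f1 x, f2 x, f3 x, f4 x)) h_computable).
by do 3?apply: computable_pair.
Qed.

End Applications.

Create HintDb computable discriminated.
#[local] Hint Resolve computable_fst computable_snd : computable.

Ltac computable_known := solve [auto with computable nocore].

(* Extended below by the closure properties under control structures. *)
Ltac computable_structure := fail.
Ltac computable_cond := fail.

Ltac computable_application := match goal with
  | |- computable (fun x => (@?f x, @?g x)) =>
      apply: (@computable_pair _ _ _ f g)
  | |- computable (fun x => ?h (@?f x) (@?g x) (@?k x) (@?l x)) =>
      apply: (@computable_app4 _ _ _ _ _ _ f g k l _ _ _ _ h);
      last computable_known
  | |- computable (fun x => ?h (@?f x) (@?g x) (@?k x)) =>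
      apply: (@computable_app3 _ _ _ _ _ f g k _ _ _ h); last computable_known
  | |- computable (fun x => ?h (@?f x) (@?g x)) =>
      apply: (@computable_app2 _ _ _ _ f g _ _ h); last computable_known
  | |- computable (fun x => ?h (@?f x)) =>
      apply: (@computable_comp _ _ _ f h); first computable_known
  end.

Ltac computable_step := cbv beta; first
  [ apply: computable_const | apply: computable_id | computable_known
  | computable_structure | computable_application | apply: computable_iteri
  | apply: computable_iter
  | lazymatch goal with
    | |- context [if _ then _ else _] => computable_cond
    end ].
Ltac computability := repeat computable_step.

Lemma computable_succ : computable S.
Proof. by apply/computable_natP; exists CSucc => n; apply: (eSucc [:: n]). Qed.
#[local] Hint Resolve computable_succ : computable.

Lemma computable_pred : computable predn.
Proof.
apply: (@eq_computable _ _ (fun n => iteri n (fun i _ => i) 0)); first by case.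
computability.
Qed.
#[local] Hint Resolve computable_pred : computable.

Lemma computable_addn : computable (fun p => p.1 + p.2).
Proof.
apply: (@eq_computable _ _ (fun p => iteri p.2 (fun _ r => r.+1) p.1)).
  by move=> [m n] /=; elim: n => [|n /= ->]; rewrite ?addn0 ?addnS.
computability.
Qed.
#[local] Hint Resolve computable_addn : computable.

Lemma computable_muln : computable (fun p => p.1 * p.2).
Proof.
apply: (@eq_computable _ _ (fun p => iteri p.2 (fun _ r => p.1 + r) 0)).
  by move=> [m n] /=; elim: n => [|n /= ->]; rewrite ?muln0 ?mulnS.
computability.
Qed.
#[local] Hint Resolve computable_muln : computable.

Lemma computable_expn : computable (fun p => p.1 ^ p.2).
Proof.
apply: (@eq_computable _ _ (fun p => iteri p.2 (fun _ r => p.1 * r) 1)).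
  by move=> [m n] /=; elim: n => [|n /= ->]; rewrite ?expn0 ?expnS.
computability.
Qed.
#[local] Hint Resolve computable_expn : computable.

Lemma computable_subn : computable (fun p => p.1 - p.2).
Proof.
apply: (@eq_computable _ _ (fun p => iteri p.2 (fun _ r => r.-1) p.1)).
  by move=> [m n] /=; elim: n => [|n /= ->]; rewrite ?subn0 ?subnS.
computability.
Qed.
#[local] Hint Resolve computable_subn : computable.

Lemma computable_nat_of_bool : computable nat_of_bool.
Proof. by exists [:: CProj 0] => b; apply: esCons (esNil _); apply: eProj. Qed.
#[local] Hint Resolve computable_nat_of_bool : computable.

Lemma computable_leq : computable (fun p => p.1 <= p.2).
Proof.
suff : computable (fun p => (p.1 <= p.2 : nat)) by [].
apply: (@eq_computable _ _ (fun p => 1 - (p.1 - p.2))).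
  by move=> [m n]; rewrite /leq; case: (m - n).
computability.
Qed.
#[local] Hint Resolve computable_leq : computable.

Lemma computable_negb : computable negb.
Proof.
apply: (@eq_computable _ _ (fun b : bool => b <= 0)); first by case.
computability.
Qed.
#[local] Hint Resolve computable_negb : computable.

Lemma computable_andb : computable (fun p => p.1 && p.2).
Proof.
apply: (@eq_computable _ _ (fun p : bool * bool => 0 < p.1 * p.2)).
  by case=> -[] [].
computability.
Qed.
#[local] Hint Resolve computable_andb : computable.

Lemma computable_eqn : computable (fun p : nat * nat => p.1 == p.2).
Proof.
apply: (@eq_computable _ _ (fun p => (p.1 <= p.2) && (p.2 <= p.1))).
  by move=> p; rewrite -eqn_leq.
computability.
Qed.
#[local] Hint Resolve computable_eqn : computable.

Lemma computable_if (X : natTupleType) (b : X -> bool) (f g : X -> nat) :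
  computable b -> computable f -> computable g ->
  computable (fun x => if b x then f x else g x).
Proof.
move=> b_computable f_computable g_computable.
apply: (@eq_computable _ _ (fun x => b x * f x + ~~ b x * g x)).
  by move=> x; case: (b x); rewrite ?mul1n ?mul0n ?addn0.
by computability.
Qed.

Ltac computable_cond ::= apply: computable_if.

(* The least [i < n] satisfying [P], and [n] if there is none. *)
Definition search (n : nat) (P : pred nat) : nat := find P (iota 0 n).

Lemma search_rec n P : search n.+1 P =
  if search n P < n then search n P else if P n then n else n.+1.
Proof.
rewrite /search -addn1 iotaD find_cat has_find size_iota add0n /=.
by case: ifP => // _; case: (P n); rewrite ?addn0.
Qed.

Lemma search_hit n P : search n P < n -> P (search n P).
Proof.
move=> lt_n; have := nth_find 0 (s := iota 0 n) (a := P).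
by rewrite has_find size_iota nth_iota //; apply.
Qed.

Lemma search_min n P i : i < search n P -> ~~ P i.
Proof.
move=> lt_i; have := before_find 0 lt_i; rewrite nth_iota => [/negbT //|].
by apply: leq_trans lt_i _; rewrite -[leqRHS](size_iota 0) find_size.
Qed.

Lemma search_leq n (P : pred nat) k : P k -> search n P <= k.
Proof. by move=> Pk; rewrite leqNgt; apply: contraL Pk => /search_min. Qed.

Lemma search_eq n (P : pred nat) k :
  k < n -> P k -> (forall i, i < k -> ~~ P i) -> search n P = k.
Proof.
move=> lt_kn Pk minP; apply/eqP; rewrite eqn_leq search_leq //= leqNgt.
apply/negP => lt_k; have := minP _ lt_k; rewrite search_hit //.
exact: ltn_trans lt_kn.
Qed.

Section BoundedOperators.
Variables (X : natTupleType) (N : X -> nat).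
Hypothesis N_computable : computable N.
Implicit Types (P : nat -> X -> bool).

Lemma computable_sum P (F : nat -> X -> nat) :
  computable (fun p : nat * X => P p.1 p.2) ->
  computable (fun p : nat * X => F p.1 p.2) ->
  computable (fun x => \sum_(0 <= i < N x | P i x) F i x).
Proof.
move=> P_computable F_computable.
apply: (@eq_computable _ _
  (fun x => iteri (N x) (fun i r => r + P i x * F i x) 0)).
  move=> x; elim: (N x) => [|n /= ->]; first by rewrite big_geq.
  rewrite [RHS]big_mkcond big_nat_recr //= -big_mkcond.
  by case: (P n x); rewrite ?mul1n ?mul0n.
by computability.
Qed.

Lemma computable_search P : computable (fun p : nat * X => P p.1 p.2) ->
  computable (fun x => search (N x) (fun i => P i x)).
Proof.
move=> P_computable; apply: (@eq_computable _ _ (fun x => iteri (N x)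
    (fun i r => if r < i then r else if P i x then i else i.+1) 0)).
  by move=> x; elim: (N x) => // n IHn; rewrite search_rec /= IHn.
by computability.
Qed.

Lemma computable_has P : computable (fun p : nat * X => P p.1 p.2) ->
  computable (fun x => has (fun i => P i x) (iota 0 (N x))).
Proof.
move=> /computable_search search_computable.
apply: (@eq_computable _ _ (fun x => search (N x) (fun i => P i x) < N x)).
  by move=> x; rewrite has_find size_iota.
by computability.
Qed.

Lemma computable_all P : computable (fun p : nat * X => P p.1 p.2) ->
  computable (fun x => all (fun i => P i x) (iota 0 (N x))).
Proof.
move=> P_computable; apply: (@eq_computable _ _
    (fun x => ~~ has (fun i => ~~ P i x) (iota 0 (N x)))).
  by move=> x; rewrite -all_predC; apply: eq_all => i /=; rewrite negbK.
apply: (computable_comp computable_negb); apply: computable_has.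
by computability.
Qed.

End BoundedOperators.

Ltac computable_structure ::= match goal with
  | |- computable (fun x => bigop.body _ _ _) => apply: computable_sum
  | |- computable (fun x => search _ _) => apply: computable_search
  | |- computable (fun x => has _ (iota 0 _)) => apply: computable_has
  | |- computable (fun x => all _ (iota 0 _)) => apply: computable_all
  end.

Lemma computable_divn : computable (fun p => p.1 %/ p.2).
Proof.
apply: (@eq_computable _ _ (fun p : nat * nat =>
  if p.2 == 0 then 0 else search p.1.+1 (fun q => p.1 < q.+1 * p.2))).
  move=> [m [|d]] //=; apply: search_eq; first exact: leq_div.
    by rewrite -ltn_divLR.
  by move=> q lt_q; rewrite -leqNgt -leq_divRL.
computability.
Qed.
#[local] Hint Resolve computable_divn : computable.

Lemma computable_modn : computable (fun p => p.1 %% p.2).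
Proof.
apply: (@eq_computable _ _ (fun p => p.1 - p.1 %/ p.2 * p.2)).
  by move=> [m d] /=; rewrite {1}(divn_eq m d) addKn.
computability.
Qed.
#[local] Hint Resolve computable_modn : computable.

Lemma computable_odd : computable odd.
Proof.
apply: (@eq_computable _ _ (fun n => n %% 2 == 1)); last computability.
by move=> n; rewrite modn2 eqb1.
Qed.
#[local] Hint Resolve computable_odd : computable.

Lemma computable_logn p : prime p -> computable (logn p).
Proof.
move=> p_pr; apply: (@eq_computable _ _
    (fun n => \sum_(0 <= k < n.-1 | n %% p ^ k.+1 == 0) 1)); last computability.
move=> n; rewrite logn_count_dvd // big_add1 [LHS]big_mkcond.
by apply: eq_bigr => k _; rewrite /dvdn; case: eqP.
Qed.

Lemma computable_trunc_log p : 1 < p -> computable (trunc_log p).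
Proof.
move=> p_gt1; apply: (@eq_computable _ _
    (fun n => search n (fun k => n < p ^ k.+1))); last computability.
case=> [|n]; first by rewrite trunc_log0.
apply: search_eq => [||k lt_k].
- exact: leq_trans (ltn_expl _ p_gt1) (trunc_logP p_gt1 _).
- exact: trunc_log_ltn.
- rewrite -leqNgt; apply: leq_trans (trunc_logP p_gt1 _) => //.
  by rewrite leq_exp2l.
Qed.
#[local] Hint Resolve computable_logn computable_trunc_log : computable.
#[local] Hint Extern 0 (is_true _) => reflexivity : computable.

(** * Lists of numbers coded as numbers *)

Definition npair a b := (a + b) ^ 2 + a.
Definition nsqrt n := search n.+1 (fun s => n < s.+1 ^ 2).
Definition nfst n := n - nsqrt n ^ 2.
Definition nsnd n := nsqrt n - nfst n.

Lemma nsqrt_npair a b : nsqrt (npair a b) = a + b.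
Proof. by apply: search_eq => [||s lt_s]; rewrite /npair; nia. Qed.

Lemma nfst_npair a b : nfst (npair a b) = a.
Proof. by rewrite /nfst nsqrt_npair /npair addKn. Qed.

Lemma nsnd_npair a b : nsnd (npair a b) = b.
Proof. by rewrite /nsnd nfst_npair nsqrt_npair addKn. Qed.

Lemma ltn_npair a b c d : a <= c -> b < d -> npair a b < npair c d.
Proof. by rewrite /npair; nia. Qed.

Lemma computable_npair : computable (fun p => npair p.1 p.2).
Proof. rewrite /npair; computability. Qed.
Lemma computable_nsqrt : computable nsqrt.
Proof. rewrite /nsqrt; computability. Qed.
#[local] Hint Resolve computable_npair computable_nsqrt : computable.
Lemma computable_nfst : computable nfst.
Proof. rewrite /nfst; computability. Qed.
#[local] Hint Resolve computable_nfst : computable.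
Lemma computable_nsnd : computable nsnd.
Proof. rewrite /nsnd; computability. Qed.
#[local] Hint Resolve computable_nsnd : computable.

Definition cons_code h t := (npair h t).+1.
Definition head_code v := nfst v.-1.
Definition behead_code v := nsnd v.-1.
Definition nth_code v i := head_code (iter i behead_code v).
Definition seq_code s := foldr cons_code 0 s.
Arguments cons_code : simpl never.

Notation "[# a ; .. ; b ]" := (cons_code a .. (cons_code b 0) ..).

Lemma computable_cons_code : computable (fun p => cons_code p.1 p.2).
Proof. rewrite /cons_code; computability. Qed.
Lemma computable_head_code : computable head_code.
Proof. rewrite /head_code; computability. Qed.
Lemma computable_behead_code : computable behead_code.
Proof. rewrite /behead_code; computability. Qed.
#[local] Hint Resolve computable_cons_code : computable.
#[local] Hint Resolve computable_head_code computable_behead_code : computable.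
Lemma computable_nth_code : computable (fun p => nth_code p.1 p.2).
Proof. rewrite /nth_code; computability. Qed.
#[local] Hint Resolve computable_nth_code : computable.

Lemma cons_code_eq0 h t : (cons_code h t == 0) = false.
Proof. by []. Qed.

Lemma head_code_cons h t : head_code (cons_code h t) = h.
Proof. exact: nfst_npair. Qed.

Lemma behead_code_cons h t : behead_code (cons_code h t) = t.
Proof. exact: nsnd_npair. Qed.

Lemma nth_code_cons h t i :
  nth_code (cons_code h t) i = if i is i'.+1 then nth_code t i' else h.
Proof.
case: i => [|i]; first exact: head_code_cons.
by rewrite /nth_code iterSr behead_code_cons.
Qed.

Lemma head_codeE s : head_code (seq_code s) = head 0 s.
Proof. by case: s => // x s; rewrite head_code_cons. Qed.

Lemma behead_codeE s : behead_code (seq_code s) = seq_code (behead s).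
Proof. by case: s => // x s; rewrite behead_code_cons. Qed.

Lemma nth_codeE s i : nth_code (seq_code s) i = nth 0 s i.
Proof.
elim: i s => [|i IHi] s; first by rewrite nth0 -head_codeE.
by rewrite /nth_code iterSr behead_codeE -/(nth_code _ _) IHi nth_behead.
Qed.

#[local] Opaque cons_code head_code behead_code nth_code.

Section CourseOfValues.
Variables (X : natTupleType) (encode : X -> nat) (decode : nat -> X).
Variable F : (X -> nat) -> X -> nat.
Hypothesis encodeK : cancel encode decode.
Hypothesis F_causal : forall g h x,
  (forall y, encode y < encode x -> g y = h y) -> F g x = F h x.

(* [cov_table n] lists the values at the points of code [n - 1, ..., 0]. *)
Definition cov_lookup n table y := nth_code table (n - (encode y).+1).
Definition cov_table n :=
  iteri n
    (fun k table => cons_code (F (cov_lookup k table) (decode k)) table) 0.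
Definition cov_rec x := F (cov_lookup (encode x) (cov_table (encode x))) x.

Lemma cov_lookupE n y : encode y < n ->
  cov_lookup n (cov_table n) y = cov_rec y.
Proof.
elim: n => // n IHn; rewrite ltnS leq_eqVlt /cov_lookup subSS.
rewrite /= nth_code_cons => /predU1P[<-|lt_n]; first by rewrite subnn encodeK.
by rewrite -subnSK // -IHn.
Qed.

Lemma cov_recE x : cov_rec x = F cov_rec x.
Proof. by apply: F_causal => y; apply: cov_lookupE. Qed.

Hypothesis encode_computable : computable encode.
Hypothesis decode_computable : computable decode.

Lemma computable_cov_rec :
  computable (fun p : nat * nat * X => F (cov_lookup p.1.1 p.1.2) p.2) ->
  computable cov_rec.
Proof.
pose F_lookup n table x := F (cov_lookup n table) x.
move=> F_computable; rewrite /cov_rec /cov_table.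
apply: (computable_app3 _ _ _ (h := F_lookup)) => //; computability.
by apply: (computable_app3 _ _ _ (h := F_lookup)) => //; computability.
Qed.

End CourseOfValues.

(** * A universal machine *)

Inductive frame :=
| EvalTail of seq code & seq nat
| ConsResult of nat
| Apply of code
| PrecStep of code & nat & seq nat
| MuTest of code & nat & seq nat.

Inductive state :=
| Eval of code & seq nat & seq frame
| Evals of seq code & seq nat & seq frame
| Return of nat & seq frame
| Returns of seq nat & seq frame.

Definition step s := match s with
  | Eval CZero _ K => Return 0 K
  | Eval CSucc xs K => Return (head 0 xs).+1 K
  | Eval (CProj i) xs K => Return (nth 0 xs i) K
  | Eval (CComp f gs) xs K => Evals gs xs (Apply f :: K)
  | Eval (CPrec f g) xs K =>
      if head 0 xs is n.+1 then
        Eval (CPrec f g) (n :: behead xs) (PrecStep g n (behead xs) :: K)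
      else Eval f (behead xs) K
  | Eval (CMu f) xs K => Eval f (0 :: xs) (MuTest f 0 xs :: K)
  | Evals [::] _ K => Returns [::] K
  | Evals (g :: gs) xs K => Eval g xs (EvalTail gs xs :: K)
  | Return y (EvalTail gs xs :: K) => Evals gs xs (ConsResult y :: K)
  | Return y (PrecStep g n xs :: K) => Eval g [:: n, y & xs] K
  | Return y (MuTest f n xs :: K) =>
      if y == 0 then Return n K
      else Eval f (n.+1 :: xs) (MuTest f n.+1 xs :: K)
  | Returns ys (ConsResult y :: K) => Returns (y :: ys) K
  | Returns ys (Apply f :: K) => Eval f ys K
  | _ => s
  end.

Definition reaches s s' := exists n, iter n step s = s'.

Lemma reaches_refl s : reaches s s. Proof. by exists 0. Qed.

Lemma reaches_trans s2 s1 s3 : reaches s1 s2 -> reaches s2 s3 -> reaches s1 s3.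
Proof. by move=> [n <-] [m <-]; exists (m + n); rewrite iterD. Qed.

Lemma reaches_step s1 s2 : reaches (step s1) s2 -> reaches s1 s2.
Proof. by move=> [n <-]; exists n.+1; rewrite iterSr. Qed.

Lemma reaches_mu f xs n K :
  (forall m, m < n -> exists k, forall L,
     reaches (Eval f (m :: xs) L) (Return k.+1 L)) ->
  reaches (Eval (CMu f) xs K) (Eval f (n :: xs) (MuTest f n xs :: K)).
Proof.
elim: n => [_|n IHn fail]; first exact/reaches_step/reaches_refl.
apply: reaches_trans (IHn _) _ => [m lt_mn|]; first exact/fail/leqW.
have [k /(_ (MuTest f n xs :: K)) run] := fail n (leqnn _).
exact/(reaches_trans run)/reaches_step/reaches_refl.
Qed.

Fixpoint eval_reaches c xs y (ev : eval c xs y) {struct ev} :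
  forall K, reaches (Eval c xs K) (Return y K)
with evals_reaches gs xs ys (ev : evals gs xs ys) {struct ev} :
  forall K, reaches (Evals gs xs K) (Returns ys K).
Proof.
- case: ev => {c xs y} [xs|xs|i xs|f gs xs ys y gs_ys f_y|f g xs y f_y
    |f g n xs r y f_r g_y|f xs n f_0 f_pos] K.
  1-3: exact/reaches_step/reaches_refl.
  + apply/reaches_step/(reaches_trans (evals_reaches _ _ _ gs_ys _)).
    exact/reaches_step/(eval_reaches _ _ _ f_y).
  + exact/reaches_step/(eval_reaches _ _ _ f_y).
  + apply/reaches_step/(reaches_trans (eval_reaches _ _ _ f_r _)).
    exact/reaches_step/(eval_reaches _ _ _ g_y).
  + apply: (reaches_trans (reaches_mu _ _)) => [m lt_mn|].
      by case: (f_pos m lt_mn) => k f_k; exists k; apply: eval_reaches f_k.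
    apply: (reaches_trans (eval_reaches _ _ _ f_0 _)).
    exact/reaches_step/reaches_refl.
- case: ev => {gs xs ys} [xs|g gs xs y ys g_y gs_ys] K.
    exact/reaches_step/reaches_refl.
  apply/reaches_step/(reaches_trans (eval_reaches _ _ _ g_y _)).
  apply/reaches_step/(reaches_trans (evals_reaches _ _ _ gs_ys _)).
  exact/reaches_step/reaches_refl.
Qed.

Fixpoint enc_program c := match c with
  | CZero => [# 0]
  | CSucc => [# 1]
  | CProj i => [# 2; i]
  | CComp f gs => [# 3; enc_program f; seq_code [seq enc_program g | g <- gs]]
  | CPrec f g => [# 4; enc_program f; enc_program g]
  | CMu f => [# 5; enc_program f]
  end.

Definition enc_programs gs := seq_code [seq enc_program g | g <- gs].

Definition enc_frame F := match F with
  | EvalTail gs xs => [# 0; enc_programs gs; seq_code xs]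
  | ConsResult y => [# 1; y]
  | Apply f => [# 2; enc_program f]
  | PrecStep g n xs => [# 3; enc_program g; n; seq_code xs]
  | MuTest f n xs => [# 4; enc_program f; n; seq_code xs]
  end.

Definition enc_stack K := seq_code [seq enc_frame F | F <- K].

Definition enc_state s := match s with
  | Eval c xs K => [# 0; enc_program c; seq_code xs; enc_stack K]
  | Evals gs xs K => [# 1; enc_programs gs; seq_code xs; enc_stack K]
  | Return y K => [# 2; y; enc_stack K]
  | Returns ys K => [# 3; seq_code ys; enc_stack K]
  end.

(* The cases of [step] on codes: [nth_code] selects the case of the tag stored
   at the head of the code of a program, frame or state. *)
Definition step_eval_code c v K := nth_code
  [# [# 2; 0; K];
     [# 2; (head_code v).+1; K];
     [# 2; nth_code v (nth_code c 1); K];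
     [# 1; nth_code c 2; v; cons_code [# 2; nth_code c 1] K];
     if head_code v == 0 then [# 0; nth_code c 1; behead_code v; K]
     else [# 0; c; cons_code (head_code v).-1 (behead_code v);
             cons_code [# 3; nth_code c 2; (head_code v).-1; behead_code v] K];
     [# 0; nth_code c 1; cons_code 0 v;
        cons_code [# 4; nth_code c 1; 0; v] K]]
  (head_code c).

Definition step_evals_code gs v K :=
  if gs == 0 then [# 3; 0; K]
  else [# 0; head_code gs; v; cons_code [# 0; behead_code gs; v] K].

Definition step_return_code s y F K := nth_code
  [# [# 1; nth_code F 1; nth_code F 2; cons_code [# 1; y] K];
     s;
     s;
     [# 0; nth_code F 1;
        cons_code (nth_code F 2) (cons_code y (nth_code F 3)); K];
     if y == 0 then [# 2; nth_code F 2; K]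
     else [# 0; nth_code F 1; cons_code (nth_code F 2).+1 (nth_code F 3);
             cons_code [# 4; nth_code F 1; (nth_code F 2).+1; nth_code F 3] K]]
  (head_code F).

Definition step_returns_code s ys F K := nth_code
  [# s; [# 3; cons_code (nth_code F 1) ys; K]; [# 0; nth_code F 1; ys; K]; s; s]
  (head_code F).

Definition step_code s := nth_code
  [# step_eval_code (nth_code s 1) (nth_code s 2) (nth_code s 3);
     step_evals_code (nth_code s 1) (nth_code s 2) (nth_code s 3);
     if nth_code s 2 == 0 then s
     else step_return_code s (nth_code s 1)
            (head_code (nth_code s 2)) (behead_code (nth_code s 2));
     if nth_code s 2 == 0 then s
     else step_returns_code s (nth_code s 1)
            (head_code (nth_code s 2)) (behead_code (nth_code s 2))]
  (head_code s).

Lemma enc_step s : enc_state (step s) = step_code (enc_state s).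
Proof.
have programsE g gs : enc_programs (g :: gs) =
  cons_code (enc_program g) (enc_programs gs) by [].
have stackE F K : enc_stack (F :: K) = cons_code (enc_frame F) (enc_stack K).
  by [].
have codeE := (nth_code_cons, head_code_cons, behead_code_cons, cons_code_eq0).
case: s => [c xs K|[|g gs] xs K|y [|F K]|ys [|F K]];
  rewrite /step_code /= ?stackE ?programsE !codeE //.
- case: c => [||i|f gs|f g|f];
    rewrite /step_eval_code /= !codeE ?nth_codeE ?head_codeE ?behead_codeE //.
  by case: xs => [|[|n] xs].
- by rewrite /step_evals_code !codeE.
- by case: F => [gs xs|z|f|g n xs|f n xs];
    rewrite /step_return_code !codeE //; case: y.
- by case: F => [gs xs|z|f|g n xs|f n xs]; rewrite /step_returns_code !codeE.
Qed.

Lemma computable_step_eval_code :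
  computable (fun p => step_eval_code p.1.1 p.1.2 p.2).
Proof. rewrite /step_eval_code; computability. Qed.
Lemma computable_step_evals_code :
  computable (fun p => step_evals_code p.1.1 p.1.2 p.2).
Proof. rewrite /step_evals_code; computability. Qed.
Lemma computable_step_return_code :
  computable (fun p => step_return_code p.1.1.1 p.1.1.2 p.1.2 p.2).
Proof. rewrite /step_return_code; computability. Qed.
Lemma computable_step_returns_code :
  computable (fun p => step_returns_code p.1.1.1 p.1.1.2 p.1.2 p.2).
Proof. rewrite /step_returns_code; computability. Qed.
#[local] Hint Resolve computable_step_eval_code : computable.
#[local] Hint Resolve computable_step_evals_code : computable.
#[local] Hint Resolve computable_step_return_code : computable.
#[local] Hint Resolve computable_step_returns_code : computable.
Lemma computable_step_code : computable step_code.
Proof. rewrite /step_code; computability. Qed.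
#[local] Hint Resolve computable_step_code : computable.

Lemma iter_step_code_return n y :
  iter n step_code [# 2; y; 0] = [# 2; y; 0].
Proof. by elim: n => //= n ->; rewrite -(enc_step (Return y [::])). Qed.

Lemma iter_step_code_eval e xs y : eval e xs y -> exists n,
  forall m, n <= m ->
    iter m step_code [# 0; enc_program e; seq_code xs; 0] = [# 2; y; 0].
Proof.
move=> /eval_reaches/(_ [::]) [n run]; exists n => m /subnK <-.
rewrite iterD -[[# 0; _; _; 0]]/(enc_state (Eval e xs [::])).
suff -> : iter n step_code (enc_state (Eval e xs [::])) = [# 2; y; 0].
  exact: iter_step_code_return.
rewrite -[RHS]/(enc_state (Return y [::])) -run.
by elim: n {run} => //= n ->; rewrite enc_step.
Qed.

(* A number [w] stands for the pair of an element of a Sigma^0_3 set and a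
   witness for the outermost quantifier of its definition. *)
Definition elt w := nth_code w 0.
Definition wit w := nth_code w 1.

Lemma computable_elt : computable elt.
Proof. rewrite /elt; computability. Qed.
Lemma computable_wit : computable wit.
Proof. rewrite /wit; computability. Qed.
#[local] Hint Resolve computable_elt computable_wit : computable.

Definition accepts e w b t := has (fun c =>
  iter t step_code [# 0; e; [# elt w; wit w; b; c]; 0] == [# 2; 1; 0])
  (iota 0 t).

Lemma computable_accepts :
  computable (fun p => accepts p.1.1.1 p.1.1.2 p.1.2 p.2).
Proof. rewrite /accepts; computability. Qed.
#[local] Hint Resolve computable_accepts : computable.

Lemma accepts_leq e w b t t' : t <= t' -> accepts e w b t -> accepts e w b t'.
Proof.
move=> le_t /hasP[c]; rewrite mem_iota => lt_c /eqP run; apply/hasP; exists c.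
  by rewrite mem_iota (leq_trans lt_c).
by rewrite -(subnK le_t) iterD run iter_step_code_return.
Qed.

Lemma accepts_enc_programP e R :
  (forall x a b c, eval e [:: x; a; b; c] (nat_of_bool (R x a b c))) ->
  forall w b, (exists t, accepts (enc_program e) w b t) <->
    exists c, R (elt w) (wit w) b c.
Proof.
move=> e_R w b.
have run c := iter_step_code_eval (e_R (elt w) (wit w) b c).
split=> [[t /hasP[c _ /eqP run_t]] | [c Rc]].
  exists c; have [n /(_ _ (leq_maxl n t))] := run c.
  rewrite -[maxn n t](subnK (leq_maxr n t)) iterD run_t iter_step_code_return.
  by move/(congr1 (nth_code^~ 1)); rewrite !nth_code_cons; case: (R _ _ b c).
have [n run_n] := run c; rewrite Rc in run_n.
exists (maxn c.+1 n); apply/hasP; exists c; last by rewrite run_n ?leq_maxr.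
by rewrite mem_iota leq_maxl.
Qed.

Lemma Sigma03_accepts A : Sigma03 A -> exists e, forall x,
  A x <-> exists2 w, elt w = x & forall b, exists t, accepts e w b t.
Proof.
move=> [R [[e e_R] A_R]]; exists (enc_program e) => x; rewrite A_R.
split=> [[a Ra]|[w <- w_acc]].
  exists [# x; a] => [|b]; first by rewrite /elt nth_code_cons.
  by apply/(accepts_enc_programP e_R); rewrite /elt /wit !nth_code_cons.
by exists (wit w) => b; apply/(accepts_enc_programP e_R).
Qed.

(** * Sums over the nonzero digits *)

Section Digits.
Variable b : nat.

Definition digit j n := n %/ b ^ j %% b.
Definition above j n := n %/ b ^ j.+1 * b ^ j.+1.
Definition digit_sum (f : nat -> nat -> nat) n :=
  \sum_(0 <= j < n | 0 < digit j n) f j (above j n).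

Hypothesis b_gt1 : 1 < b.

Let expb_gt0 k : 0 < b ^ k. Proof. by rewrite expn_gt0 ltnW. Qed.

Lemma digit_trunc_log_gt0 n : 0 < n -> 0 < digit (trunc_log b n) n.
Proof.
move=> n_gt0; have /andP[le_n lt_n] := trunc_log_bounds b_gt1 n_gt0.
by rewrite /digit modn_small ?divn_gt0 // ltn_divLR // -expnS.
Qed.

Lemma above_small j n : n < b ^ j.+1 -> above j n = 0.
Proof. by move=> lt_n; rewrite /above divn_small. Qed.

Lemma above_add_leq i j n : n < b ^ j.+1 -> i < j ->
  above i n + b ^ i.+1 <= b ^ j.+1.
Proof.
move=> lt_n lt_ij; rewrite /above -mulSnr -(subnK (leqW lt_ij)) expnD.
by rewrite leq_mul2r ltn_divLR // -expnD subnK ?lt_n ?orbT // leqW.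
Qed.

Lemma digit_addl k i x u : b ^ k %| u -> i < k -> digit i (x + u) = digit i x.
Proof.
move=> /dvdnP[q ->] lt_ik; rewrite /digit -(subnK lt_ik) -addSnnS expnD expnSr.
by rewrite !mulnA addnC divnMDl // modnMDl.
Qed.

Lemma digit_dvd k i u : b ^ k %| u -> i < k -> digit i u = 0.
Proof.
move=> dvd_u lt_ik; rewrite -[u]add0n (digit_addl 0 dvd_u) //.
by rewrite /digit div0n mod0n.
Qed.

Lemma above_addl k i x u : b ^ k %| u -> i < k ->
  above i (x + u) = above i x + u.
Proof.
move=> /dvdnP[q ->] lt_ik; rewrite /above -(subnK lt_ik) expnD mulnA addnC.
by rewrite divnMDl // mulnDl addnC.
Qed.

Lemma divn_exp_addl k i x u : x < b ^ k -> b ^ k %| u -> k <= i ->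
  (x + u) %/ b ^ i = u %/ b ^ i.
Proof.
move=> lt_x /dvdnP[q ->] /subnKC <-; rewrite expnD !divnMA addnC divnMDl //.
by rewrite mulnK // (divn_small lt_x) addn0.
Qed.

Lemma digit_sum_widen f n m : n <= m ->
  digit_sum f n = \sum_(0 <= j < m | 0 < digit j n) f j (above j n).
Proof.
move=> le_nm; rewrite (big_cat_nat _ le_nm) //= [X in _ = _ + X]big_nat_cond.
rewrite [X in _ = _ + X]big_pred0 ?addn0 // => j.
apply/negP => /andP[/andP[le_nj _]].
by rewrite /digit divn_small ?mod0n // (leq_ltn_trans le_nj) // ltn_expl.
Qed.

Lemma digit_sumD f k x u : x < b ^ k -> b ^ k %| u -> digit_sum f (x + u) =
  \sum_(0 <= i < k | 0 < digit i x) f i (above i x + u) + digit_sum f u.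
Proof.
move=> lt_x dvd_u; have le_k := leq_addr (x + u) k.
rewrite (digit_sum_widen _ (leq_addl k _)).
rewrite (digit_sum_widen _ (leq_trans (leq_addl x u) (leq_addl k _))).
rewrite !(big_cat_nat (leq0n k) le_k) /=.
rewrite [X in _ = _ + (X + _)]big_nat_cond.
rewrite [X in _ = _ + (X + _)]big_pred0 => [|i]; last first.
  by apply/negP => /andP[/andP[_ lt_ik]]; rewrite (digit_dvd dvd_u).
congr (_ + _); rewrite big_nat_cond [RHS]big_nat_cond; apply: eq_big => i.
- by apply: andb_id2l => /andP[_ lt_ik]; rewrite (digit_addl x dvd_u).
- by move=> /andP[/andP[_ lt_ik] _]; rewrite (above_addl x dvd_u).
- by apply: andb_id2l => /andP[le_ki _]; rewrite /digit (divn_exp_addl lt_x).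
- move=> /andP[/andP[le_ki _] _].
  by rewrite /above (divn_exp_addl lt_x) // leqW.
Qed.

End Digits.

Lemma computable_digit : computable (fun p => digit p.1.1 p.1.2 p.2).
Proof. rewrite /digit; computability. Qed.
Lemma computable_above : computable (fun p => above p.1.1 p.1.2 p.2).
Proof. rewrite /above; computability. Qed.
#[local] Hint Resolve computable_digit computable_above : computable.

(** * The colouring *)

Definition lead w := trunc_log 3 (elt w).

Definition plausible e w b t :=
  (0 < elt w) && all (fun i => accepts e w i t) (iota 0 b).

Lemma computable_lead : computable lead.
Proof. rewrite /lead; computability. Qed.
Lemma computable_plausible :
  computable (fun p => plausible p.1.1.1 p.1.1.2 p.1.2 p.2).
Proof. rewrite /plausible; computability. Qed.
#[local] Hint Resolve computable_lead computable_plausible : computable.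

Definition guess_code (eu : nat * nat) := npair eu.2 eu.1.
Definition guess_decode k := (nsnd k, nfst k).
Definition guess_step (g : nat * nat -> nat) (eu : nat * nat) :=
  search eu.2 (fun w => plausible eu.1 w (logn 3 eu.2) eu.2 &&
    all (fun i => lead (g (i, eu.2)) != lead w) (iota 0 eu.1)).
Definition guess e u := cov_rec guess_code guess_decode guess_step (e, u).

Lemma guessE e u : guess e u = search u (fun w => plausible e w (logn 3 u) u &&
  all (fun i => lead (guess i u) != lead w) (iota 0 e)).
Proof.
apply: cov_recE => [[{}e {}u]|g h [{}e {}u] eq_gh].
  by rewrite /guess_decode nfst_npair nsnd_npair.
apply: eq_find => w; congr (_ && _); apply: eq_in_all => i.
by rewrite mem_iota => lt_ie; rewrite eq_gh // ltn_npair.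
Qed.

Lemma computable_guess : computable (fun p => guess p.1 p.2).
Proof.
apply: (@eq_computable _ _ (cov_rec guess_code guess_decode guess_step)).
  by case.
apply: computable_cov_rec; rewrite /guess_step /cov_lookup /guess_code;
  rewrite /guess_decode; computability.
Qed.
#[local] Hint Resolve computable_guess : computable.

(* If no requirement [e < u] leads at position [j], this is the element of an
   arbitrary guess; the test in [weight_step] discards it unless its leading
   position happens to be [j], in which case it is a legitimate target. *)
Definition target j u :=
  elt (guess (search u (fun e => lead (guess e u) == j)) u).

Lemma computable_target : computable (fun p => target p.1 p.2).
Proof. rewrite /target; computability. Qed.
#[local] Hint Resolve computable_target : computable.

(* Calls go from [(j, u)] to pairs [(i, v)] with [i < j] and
   [v + 3 ^ i.+1 <= u + 3 ^ j.+1], and so decrease this code. *)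
Definition weight_code (ju : nat * nat) := npair (ju.2 + 3 ^ ju.1.+1) ju.1.
Definition weight_decode k := (nsnd k, nfst k - 3 ^ (nsnd k).+1).
Definition weight_step (g : nat * nat -> nat) (ju : nat * nat) :=
  let t := target ju.1 ju.2 in
  if trunc_log 3 t == ju.1 then
    (\sum_(0 <= i < ju.1 | 0 < digit 3 i t) g (i, above 3 i t + ju.2)).+1
  else 0.
Definition weight j u := cov_rec weight_code weight_decode weight_step (j, u).

Lemma weightE j u : weight j u =
  if trunc_log 3 (target j u) == j then
    (\sum_(0 <= i < j | 0 < digit 3 i (target j u))
        weight i (above 3 i (target j u) + u)).+1
  else 0.
Proof.
apply: cov_recE => [[{}j {}u]|g h [{}j {}u] eq_gh].
  by rewrite /weight_decode nfst_npair nsnd_npair addnK.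
rewrite /weight_step /=; case: eqP => // lead_t; congr _.+1.
rewrite big_nat_cond [RHS]big_nat_cond; apply: eq_bigr => i /andP[lt_ij _].
have lt_t := trunc_log_ltn (target j u) (isT : 1 < 3); rewrite lead_t in lt_t.
rewrite eq_gh // ltn_npair //=; have := above_add_leq _ lt_t lt_ij; lia.
Qed.

Lemma computable_weight : computable (fun p => weight p.1 p.2).
Proof.
apply: (@eq_computable _ _ (cov_rec weight_code weight_decode weight_step)).
  by case.
apply: computable_cov_rec; rewrite /weight_step /cov_lookup /weight_code;
  rewrite /weight_decode; computability.
Qed.
#[local] Hint Resolve computable_weight : computable.

Definition parity n := odd (digit_sum 3 weight n).
Definition low_digit n := digit 3 (logn 3 n) n.
Definition colouring n : colour3 := (low_digit n == 1, parity n, false).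

Lemma colouring_recursive : recursive_coloring colouring.
Proof.
suff /computable_natP : computable
  (fun n => 4 * (low_digit n == 1) + 2 * parity n + false) by [].
rewrite /parity /low_digit /digit_sum; computability.
Qed.

Lemma parity_add_target x u : 0 < x -> 3 ^ (trunc_log 3 x).+1 %| u ->
  target (trunc_log 3 x) u = x -> parity (x + u) = ~~ parity u.
Proof.
set j := trunc_log 3 x => x_gt0 dvd_u target_x.
have lt_x : x < 3 ^ j.+1 by apply: trunc_log_ltn.
rewrite /parity (digit_sumD _ _ lt_x) // big_mkcond big_nat_recr //=.
rewrite digit_trunc_log_gt0 // above_small // add0n weightE target_x eqxx.
by rewrite -big_mkcond addnS !oddD /= oddD addbb.
Qed.

Lemma low_digit_add y z : 0 < y -> 0 < z -> logn 3 y = logn 3 z ->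
  (low_digit y == 1) = (low_digit z == 1) ->
  (low_digit (y + z) == 1) != (low_digit y == 1).
Proof.
have low_digitM m k : coprime 3 m -> low_digit (m * 3 ^ k) = m %% 3.
  move=> co_m; have m_gt0 : 0 < m by case: m co_m.
  rewrite /low_digit lognM ?expn_gt0 // pfactorK // (logn_coprime co_m).
  by rewrite /digit mulnK ?expn_gt0.
move=> y_gt0 z_gt0 eq_logn.
have [a co_a eq_y] := pfactor_coprime (isT : prime 3) y_gt0.
have [b co_b eq_z] := pfactor_coprime (isT : prime 3) z_gt0.
rewrite -eq_logn in eq_z; move: (logn 3 y) eq_y eq_z => k -> ->.
rewrite -mulnDl (low_digitM a) // (low_digitM b) // => eq_ab.
move: co_a co_b; rewrite !prime_coprime // /dvdn => a_neq0 b_neq0.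
by rewrite low_digitM ?prime_coprime // /dvdn; lia.
Qed.

(** * Diagonalization *)

Definition eventually (P : nat -> Prop) := exists N, forall n, N <= n -> P n.

Lemma eventually_geq N : eventually (fun n => N <= n).
Proof. by exists N. Qed.

Lemma eventually_and P Q : eventually P -> eventually Q ->
  eventually (fun n => P n /\ Q n).
Proof.
move=> [N P_N] [M Q_M]; exists (maxn N M) => n; rewrite geq_max => /andP[? ?].
by split; [apply: P_N | apply: Q_M].
Qed.

Lemma eventually_forall_lt (P : nat -> nat -> Prop) k :
  (forall i, i < k -> eventually (P i)) ->
  eventually (fun n => forall i, i < k -> P i n).
Proof.
elim: k => [|k IHk] evP; first by exists 0.
have [|N P_N] := eventually_and (IHk _) (evP k (leqnn _)).
  by move=> i lt_ik; apply/evP/leqW.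
exists N => n /P_N[Plt Pk] i; rewrite ltnS leq_eqVlt => /predU1P[-> //|].
exact: Plt.
Qed.

Lemma eventually_imply (Q : Prop) P : (Q -> eventually P) ->
  eventually (fun n => Q -> P n).
Proof.
case: (classic Q) => [q /(_ q)[N P_N]|notQ _]; last by exists 0.
by exists N => n /P_N.
Qed.

Lemma infinite_eventually A P : infinite_set A -> eventually P ->
  exists2 n, A n & P n.
Proof.
by move=> infA [N P_N]; have [n [le_Nn An]] := infA N; exists n; auto.
Qed.

Lemma not_eventually P : ~ eventually P -> infinite_set (fun n => ~ P n).
Proof.
move=> notP m; apply: NNPP => none; apply: notP; exists m => n le_mn.
by apply: NNPP => notPn; apply: none; exists n.
Qed.

Lemma uniq_pigeonhole (T : eqType) (s r : seq T) :
  uniq s -> size r < size s -> exists2 x, x \in s & x \notin r.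
Proof.
move=> uniq_s lt_rs; apply/allPn; apply: contraL lt_rs => /allP sub_sr.
by rewrite -leqNgt uniq_leq_size.
Qed.

Lemma target_guess e u : e < u -> guess e u < u ->
  target (lead (guess e u)) u = elt (guess e u).
Proof.
move=> lt_eu lt_guess; rewrite /target (@search_eq _ _ e) // => i lt_ie.
move: lt_guess; rewrite {1}guessE => /search_hit/andP[_ /allP fresh].
by rewrite [guess e u]guessE fresh // mem_iota.
Qed.

Section Requirement.
Variables (A : nat -> Prop) (e : nat).
Hypothesis infA : infinite_set A.
Hypothesis A_accepts : forall x,
  A x <-> exists2 w, elt w = x & forall b, exists t, accepts e w b t.

Definition genuine w := 0 < elt w /\ forall b, exists t, accepts e w b t.

Lemma genuine_plausible w b : genuine w -> eventually (plausible e w b).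
Proof.
move=> [elt_gt0 w_acc].
have [|N acc_N] := @eventually_forall_lt (accepts e w) b.
  by move=> i _; have [t] := w_acc i; exists t => t' /accepts_leq; apply.
exists N => n /acc_N acc_n; rewrite /plausible elt_gt0; apply/allP => i.
by rewrite mem_iota => /acc_n.
Qed.

Lemma not_genuine_implausible w :
  ~ genuine w -> eventually (fun b => forall t, ~~ plausible e w b t).
Proof.
move=> not_w; apply: NNPP => /not_eventually inf_b; apply: not_w.
have plausible_ge b : exists b' t, b <= b' /\ plausible e w b' t.
  have [b' [le_b /not_all_ex_not[t /negP]]] := inf_b b.
  by rewrite negbK => pl; exists b', t.
split=> [|b]; first by have [b [t [_ /andP[]]]] := plausible_ge 0.
have [b' [t [le_b /andP[_ /allP acc_t]]]] := plausible_ge b.+1.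
by exists t; apply: acc_t; rewrite mem_iota.
Qed.

Lemma genuine_distinct_leads n : exists s : seq nat,
  [/\ size s = n, {in s, forall w, genuine w} & uniq [seq lead w | w <- s]].
Proof.
elim: n => [|n [s [size_s genuine_s uniq_s]]]; first by exists [::].
pose m := (\max_(w <- s) lead w).+1.
have [x Ax le_x] := infinite_eventually infA (eventually_geq (3 ^ m)).
have [w elt_w w_acc] := (A_accepts x).1 Ax.
exists (w :: s); split=> [|v|/=]; first by rewrite /= size_s.
  rewrite inE => /predU1P[->|/genuine_s //]; split=> //.
  by rewrite elt_w (leq_trans _ le_x) ?expn_gt0.
rewrite uniq_s andbT; apply/mapP => -[v v_s eq_lead].
have le_m : m <= lead w by rewrite /lead elt_w trunc_log_max.
by move: le_m; rewrite eq_lead ltnNge (leq_bigmax_seq v).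
Qed.

Lemma guess_genuine : exists W, eventually (fun b => eventually (fun u =>
  logn 3 u = b -> guess e u < W /\ genuine (guess e u))).
Proof.
have [s [size_s genuine_s uniq_s]] := genuine_distinct_leads e.+1.
pose W := (\max_(w <- s) w).+1; exists W.
have lt_W w : w \in s -> w < W by move=> w_s; rewrite ltnS (leq_bigmax_seq w).
have [B implausible_B] : eventually (fun b => forall w, w < W ->
    ~ genuine w -> forall t, ~~ plausible e w b t).
  apply: eventually_forall_lt => w _; apply: eventually_imply.
  exact: not_genuine_implausible.
exists B => b /implausible_B implausible_b.
have [N plausible_N] : eventually (fun u => forall w, w < W ->
    genuine w -> plausible e w b u).
  apply: eventually_forall_lt => w _; apply: eventually_imply.
  exact: genuine_plausible.
exists (maxn N W) => u.
rewrite geq_max => /andP[/plausible_N plausible_u le_Wu] logn_u.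
have [|_ /mapP[w w_s ->] fresh_w] := @uniq_pigeonhole _ _
    [seq lead (guess i u) | i <- iota 0 e] uniq_s.
  by rewrite !size_map size_iota size_s.
have le_w : guess e u <= w.
  rewrite guessE search_leq // logn_u plausible_u ?lt_W //=; last first.
    exact: genuine_s.
  by apply/allP => i i_e; apply: contraNneq fresh_w => <-; apply: map_f.
have lt_guess := leq_ltn_trans le_w (lt_W w w_s); split=> //.
apply: NNPP => /(implausible_b _ lt_guess)/(_ u)/negP; apply.
have := leq_trans lt_guess le_Wu; rewrite guessE => /search_hit.
by rewrite logn_u => /andP[].
Qed.

Lemma eventually_parity_flip : eventually (fun b => eventually (fun u =>
  logn 3 u = b ->
  exists x, [/\ A x, x < 3 ^ b & parity (x + u) = ~~ parity u])).
Proof.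
have [W [B guess_B]] := guess_genuine; pose m := (\max_(w < W) lead w).+1.
exists (maxn B m) => b; rewrite geq_max => /andP[/guess_B[N guess_N] le_mb].
exists (maxn N (maxn e W).+1) => u; rewrite !geq_max gtn_max.
move=> /and3P[le_Nu lt_eu lt_Wu] logn_u.
have [lt_guess [x_gt0 acc_guess]] := guess_N u le_Nu logn_u.
set w := guess e u in lt_guess x_gt0 acc_guess.
have lt_lead : lead w < b.
  apply: leq_trans le_mb; rewrite ltnS.
  exact: (leq_bigmax (F := fun i : 'I_W => lead i) (Ordinal lt_guess)).
have lt_x := trunc_log_ltn (elt w) (isT : 1 < 3).
exists (elt w); split; first by apply/A_accepts; exists w.
  by apply: leq_trans lt_x _; rewrite leq_exp2l.
apply: parity_add_target => //.
  by apply: dvdn_trans (pfactor_dvdnn 3 u); rewrite dvdn_exp2l // logn_u.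
exact: target_guess (ltn_trans lt_guess lt_Wu).
Qed.

End Requirement.

Lemma logn_addr p m n : prime p -> 0 < m -> p ^ (logn p m).+1 %| n ->
  logn p (m + n) = logn p m.
Proof.
move=> p_pr m_gt0 dvd_n; have mn_gt0 : 0 < m + n by rewrite addn_gt0 m_gt0.
apply/eqP; rewrite eqn_leq; apply/andP; split.
  by rewrite leqNgt -pfactor_dvdn // dvdn_addl // pfactor_dvdn // ltnn.
rewrite -pfactor_dvdn // dvdn_add ?pfactor_dvdnn //.
by apply: dvdn_trans dvd_n; rewrite dvdn_exp2l.
Qed.

Lemma FSle_sumn k A s : sorted ltn s -> {in s, forall x, A x} ->
  0 < size s <= k -> FSle k A (sumn s).
Proof.
move=> sorted_s A_s /andP[s_gt0 s_le]; exists s; split=> //.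
exact: sorted_uniq ltn_trans ltnn _ sorted_s.
Qed.

Section Solution.
Variables (A : nat -> Prop) (col : colour3).
Hypothesis A_col : forall n, FSle 3 A n -> colouring n = col.

Lemma colouring_mem x : A x -> colouring x = col.
Proof.
move=> Ax; rewrite -[x]addn0; apply/A_col/(@FSle_sumn _ _ [:: x]) => // t.
by rewrite inE => /eqP->.
Qed.

Lemma colouring_sum_two x y : A x -> A y -> x < y -> colouring (x + y) = col.
Proof.
move=> Ax Ay lt_xy; rewrite -[y]addn0.
apply/A_col/(@FSle_sumn _ _ [:: x; y]); rewrite /= ?lt_xy // => t.
by rewrite !inE => /orP[] /eqP->.
Qed.

Lemma colouring_sum_three x y z : A x -> A y -> A z -> x < y < z ->
  colouring (x + (y + z)) = col.
Proof.
move=> Ax Ay Az lt_xyz; rewrite -[z]addn0.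
apply/A_col/(@FSle_sumn _ _ [:: x; y; z]); rewrite /= ?andbT // => t.
by rewrite !inE => /or3P[] /eqP->.
Qed.

Lemma solution_eventually_dvd M : eventually (fun y => A y -> 3 ^ M %| y).
Proof.
elim: M => [|M [N dvd_N]]; first by exists 0 => y _ _; rewrite dvd1n.
apply: NNPP => /not_eventually not_dvd.
have inf_ndvd : infinite_set (fun n => A n /\ ~ 3 ^ M.+1 %| n).
  move=> m; have [n [le_mn ndvd_n]] := not_dvd m; exists n; split=> //.
  exact: imply_to_and ndvd_n.
have logn_eq n : A n -> N <= n -> ~ 3 ^ M.+1 %| n -> 0 < n /\ logn 3 n = M.
  move=> An le_Nn /negP ndvd_n.
  have n_gt0 : 0 < n by rewrite lt0n; apply: contraNneq ndvd_n => ->.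
  split=> //; apply/eqP; rewrite eqn_leq leqNgt -!pfactor_dvdn // ndvd_n.
  exact: dvd_N.
have [y [le_Ny [Ay ndvd_y]]] := inf_ndvd N.
have [z [lt_yz [Az ndvd_z]]] := inf_ndvd y.+1.
have [y_gt0 logn_y] := logn_eq y Ay le_Ny ndvd_y.
have [z_gt0 logn_z] := logn_eq z Az (leq_trans le_Ny (ltnW lt_yz)) ndvd_z.
have low_col n : colouring n = col -> (low_digit n == 1) = col.1.1 by move=> <-.
have low_y := low_col _ (colouring_mem Ay).
have low_z := low_col _ (colouring_mem Az).
have low_yz := low_col _ (colouring_sum_two Ay Az lt_yz).
have := low_digit_add y_gt0 z_gt0.
by rewrite logn_y logn_z low_y low_z low_yz eqxx => /(_ erefl erefl).
Qed.

Lemma solution_dvd_geq M N : infinite_set A ->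
  exists y, [/\ A y, 0 < y, N <= y & 3 ^ M %| y].
Proof.
move=> infA; have [y Ay []] := infinite_eventually infA
  (eventually_and (eventually_geq (maxn 1 N)) (solution_eventually_dvd M)).
rewrite geq_max => /andP[y_gt0 le_Ny] dvd_y.
by exists y; split=> //; apply: dvd_y.
Qed.

End Solution.

Lemma not_HT_solution A :
  infinite_set A -> Sigma03 A -> ~ HT_solution 3 colouring A.
Proof.
move=> infA /Sigma03_accepts[e A_accepts] [_ [col A_col]].
have [B flip_B] := eventually_parity_flip infA A_accepts.
have [y [Ay y_gt0 _ dvd_y]] := solution_dvd_geq A_col B 0 infA.
have le_B : B <= logn 3 y by rewrite -pfactor_dvdn.
have [N flip_N] := flip_B _ le_B.
have [z [Az _]] := solution_dvd_geq A_col (logn 3 y).+1 (maxn N y.+1) infA.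
rewrite geq_max => /andP[le_Nz lt_yz] dvd_z.
have logn_yz : logn 3 (y + z) = logn 3 y by apply: logn_addr.
have le_Nyz : N <= y + z by rewrite (leq_trans le_Nz) ?leq_addl.
have [x [Ax lt_x parity_x]] := flip_N _ le_Nyz logn_yz.
have lt_xyz : x < y < z.
  by rewrite lt_yz andbT (leq_trans lt_x) // dvdn_leq ?pfactor_dvdnn.
have := colouring_sum_three A_col Ax Ay Az lt_xyz.
rewrite -(colouring_sum_two A_col Ay Az lt_yz) => -[_].
by rewrite parity_x; case: (parity _).
Qed.

Theorem theorem4p2 :
  exists c : nat -> colour3,
    recursive_coloring c /\
    forall A : nat -> Prop, infinite_set A -> Delta03 A -> ~ HT_solution 3 c A.
Proof.
exists colouring; split; first exact: colouring_recursive.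
by move=> A infA [sigmaA _]; apply: not_HT_solution.
Qed.
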